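(* If a weighted tetrahedron $(\mathcal T,O)$ (with $O\in\operatorname{int}\mathcal T$) is monostable, then it has an unstable equilibrium on exactly two of its vertices.
   Context: $(\mathcal P,O)$, for a convex polyhedron $\mathcal P$ and $O\in\operatorname{int}\mathcal P$, is in equilibrium on a face, edge or vertex $X$ if there exists $Q$ in the relative interior of $X$ (a vertex being its own relative interior) such that the plane perpendicular to $[O,Q]$ at $Q$ supports $\mathcal P$; equilibria on faces are stable, on vertices unstable. $(\mathcal P,O)$ is monostable if exactly one face carries an equilibrium. *)

(* Defs.v *)
From HB Require Import structures.
From mathcomp Require Import all_boot all_order all_algebra.
From mathcomp Require Import reals.
Set Implicit Arguments. Unset Strict Implicit. Unset Printing Implicit Defensive.
Import Order.TTheory GRing.Theory Num.Theory.
Local Open Scope ring_scope.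

Section Tetra.
Variable R : realType.
Implicit Types (x y O Q : 'rV[R]_3).

Definition dot x y : R := \sum_(i < 3) x 0 i * y 0 i.

(* A tetrahedron is given by its four affinely independent vertices v. *)
Definition aff_indep (v : 'I_4 -> 'rV[R]_3) : Prop :=
  \det (\matrix_(i < 3, j < 3) (v (lift ord0 i) 0 j - v ord0 0 j)) != 0.

Definition hull (v : 'I_4 -> 'rV[R]_3) (S : {set 'I_4}) x : Prop :=
  exists l : 'I_4 -> R, (forall i, 0 <= l i) /\ (forall i, i \notin S -> l i = 0)
    /\ \sum_i l i = 1 /\ x = \sum_i l i *: v i.

Definition aff (v : 'I_4 -> 'rV[R]_3) (S : {set 'I_4}) x : Prop :=
  exists l : 'I_4 -> R, (forall i, i \notin S -> l i = 0)
    /\ \sum_i l i = 1 /\ x = \sum_i l i *: v i.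

(* relative interior of conv{v_i | i in S} (a vertex is its own relative interior) *)
Definition relint (v : 'I_4 -> 'rV[R]_3) (S : {set 'I_4}) x : Prop :=
  hull v S x /\ exists eps : R, 0 < eps /\
    forall y, aff v S y -> dot (y - x) (y - x) < eps -> hull v S y.

Definition interior (v : 'I_4 -> 'rV[R]_3) x : Prop :=
  exists eps : R, 0 < eps /\ forall y, dot (y - x) (y - x) < eps -> hull v setT y.

(* the plane through Q perpendicular to [O,Q] supports T *)
Definition supports (v : 'I_4 -> 'rV[R]_3) O Q : Prop :=
  hull v setT Q /\
  ((forall x, hull v setT x -> dot (x - Q) (Q - O) <= 0) \/
   (forall x, hull v setT x -> dot (x - Q) (Q - O) >= 0)).

Definition equilibrium_on (v : 'I_4 -> 'rV[R]_3) O (S : {set 'I_4}) : Prop :=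
  exists Q, relint v S Q /\ Q != O /\ supports v O Q.

(* faces of T: conv of 3 vertices; vertices of T: single vertices *)
Definition monostable (v : 'I_4 -> 'rV[R]_3) O : Prop :=
  exists F : {set 'I_4}, [/\ #|F| = 3%N, equilibrium_on v O F &
    forall G : {set 'I_4}, #|G| = 3%N -> equilibrium_on v O G -> G = F].

End Tetra.

(* Main.v *)
(* Let [w] be the polar tetrahedron about [O], with Gram matrix [G]. Face [k] carries no
   equilibrium only if [G k k <= G i k] for some [i != k], and then [w i] is longer than
   [w k]; so monostability makes the faces roll along a rooted tree whose edges have [G >
   0]. A positive combination of the [w i] vanishes, so the pairs with [G < 0] connect all
   four indices; hence the tree is a path a - b - c - d and all remaining entries are
   negative. Dually, vertex [k] is an equilibrium iff the foot of [O] on the plane of the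
   three [w i], [i != k], has nonnegative barycentric coordinates. By these signs and the
   rolling inequalities, one coordinate is negative for [k = a] (at c) and for [k = d] (at
   b), and none is for [k = b] or [k = c]. *)
Require Import Defs.
From HB Require Import structures.
From mathcomp Require Import all_boot all_order all_algebra.
From mathcomp Require Import reals.
From mathcomp Require Import ring lra.
Set Implicit Arguments.
Unset Strict Implicit.
Unset Printing Implicit Defensive.
Import Order.TTheory GRing.Theory Num.Theory.
Local Open Scope ring_scope.

(** * The dot product: bilinearity, definiteness, Cauchy-Schwarz *)

Lemma dotC (R : realType) (x y : 'rV[R]_3) : dot x y = dot y x.
Proof. by apply: eq_bigr => i _; rewrite mulrC. Qed.

Lemma dotDl (R : realType) (x y z : 'rV[R]_3) : dot (x + y) z = dot x z + dot y z.
Proof. by rewrite -big_split; apply: eq_bigr => i _; rewrite mxE mulrDl. Qed.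

Lemma dotZl (R : realType) (c : R) (x z : 'rV[R]_3) : dot (c *: x) z = c * dot x z.
Proof. by rewrite mulr_sumr; apply: eq_bigr => i _; rewrite mxE mulrA. Qed.

Lemma dotNl (R : realType) (x z : 'rV[R]_3) : dot (- x) z = - dot x z.
Proof. by rewrite -scaleN1r dotZl mulN1r. Qed.

Lemma dotDr (R : realType) (x y z : 'rV[R]_3) : dot z (x + y) = dot z x + dot z y.
Proof. by rewrite dotC dotDl !(dotC z). Qed.

Lemma dotZr (R : realType) (c : R) (x z : 'rV[R]_3) : dot z (c *: x) = c * dot z x.
Proof. by rewrite dotC dotZl (dotC z). Qed.

Lemma dotNr (R : realType) (x z : 'rV[R]_3) : dot z (- x) = - dot z x.
Proof. by rewrite dotC dotNl (dotC z). Qed.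

Lemma dot0l (R : realType) (z : 'rV[R]_3) : dot 0 z = 0.
Proof. by rewrite -[0](scale0r 0) dotZl mul0r. Qed.

Lemma dot_suml (R : realType) (I : finType) (F : I -> 'rV[R]_3) (z : 'rV[R]_3) :
  dot (\sum_i F i) z = \sum_i dot (F i) z.
Proof.
by elim/big_rec2: _ => [|i x y _ IH]; rewrite ?dot0l // dotDl IH.
Qed.

Definition dotE := (dotDl, dotNl, dotZl, dotDr, dotNr, dotZr).

Lemma dot_ge0 (R : realType) (x : 'rV[R]_3) : 0 <= dot x x.
Proof. by apply: sumr_ge0 => i _; rewrite -expr2 sqr_ge0. Qed.

Lemma dot_gt0 (R : realType) (x y : 'rV[R]_3) : dot x y != 0 -> 0 < dot x x.
Proof.
move=> xy; rewrite lt_neqAle dot_ge0 andbT eq_sym; apply: contra xy => /eqP xx.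
have x0 i : x 0 i = 0.
  apply/eqP; rewrite -sqrf_eq0 eq_le sqr_ge0 andbT -xx /dot (bigD1 i) //= -expr2.
  by rewrite lerDl sumr_ge0 // => j _; rewrite -expr2 sqr_ge0.
by apply/eqP; apply: big1 => i _; rewrite x0 mul0r.
Qed.

Lemma dot_CS (R : realType) (x y : 'rV[R]_3) : dot x y ^+ 2 <= dot x x * dot y y.
Proof.
have [->|] := eqVneq (dot x y) 0; first by rewrite expr0n mulr_ge0 ?dot_ge0.
move=> /dot_gt0 x0; rewrite -subr_ge0 -(pmulr_rge0 _ x0).
suff -> : dot x x * (dot x x * dot y y - dot x y ^+ 2) =
  dot (dot x x *: y - dot x y *: x) (dot x x *: y - dot x y *: x) by exact: dot_ge0.
rewrite !dotE (dotC y x); ring.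
Qed.

(* With the origin inside the tetrahedron [p] at barycentric coordinates [l], the vector
   [w k] is the pole of the face opposite to [p k]. *)
Definition polar_pair (R : realType) (w p : 'I_4 -> 'rV[R]_3) (l : 'I_4 -> R) :=
  [/\ forall i, 0 < l i, \sum_i l i *: w i = 0,
      forall k i, dot (w k) (p i) = 1 - (k == i)%:R / l k
    & forall x, (forall k, dot (w k) x = 0) -> x = 0].

Lemma mem_ord4 (a b c d i : 'I_4) :
  uniq [:: a; b; c; d] -> i \in [:: a; b; c; d].
Proof.
move=> U; have [||_ ->] := uniq_min_size (s2 := enum 'I_4) U; rewrite ?mem_enum //.
  by move=> j; rewrite mem_enum.
by rewrite size_enum_ord.
Qed.

Lemma sum_ord4 (V : zmodType) (F : 'I_4 -> V) (a b c d : 'I_4) :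
  uniq [:: a; b; c; d] -> \sum_i F i = F a + F b + F c + F d.
Proof.
move=> U; have P : perm_eq (index_enum 'I_4) [:: a; b; c; d].
  by rewrite uniq_perm ?index_enum_uniq // => i; rewrite mem_index_enum mem_ord4.
by rewrite (perm_big _ P) /= !big_cons big_nil addr0 !addrA.
Qed.

(** * Gram entries of the polar vectors and signs of the foot coordinates *)

Section Polar.
Context (R : realType) (w p : 'I_4 -> 'rV[R]_3) (l : 'I_4 -> R).
Hypothesis wp : polar_pair w p l.
Local Notation G i j := (dot (w i) (w j)).

Definition gram2 i j := G i i * G j j - G i j ^+ 2.

(* Up to a positive factor, the barycentric coordinate at [w i] of the foot of the
   perpendicular from the origin to the plane through [w i], [w j], [w k]. *)
Definition foot_coord i j k :=
  gram2 j k - (G i j * (G k k - G j k) + G i k * (G j j - G j k)).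

(** Differences cancel the constant 1 of the pairing, so an edge of [p] is orthogonal to both [w k]
    whose index is not an endpoint. *)
Lemma polar_edge k i j : dot (w k) (p i - p j) = (k == j)%:R / l k - (k == i)%:R / l k.
Proof. case: wp => _ _ H _; rewrite !dotE !H; ring. Qed.

Lemma gram1_gt0 i : 0 < G i i.
Proof.
have [j ij] : exists j, i != j.
  by case: (eqVneq i ord0) => [->|]; [exists ord_max | exists ord0].
apply: (@dot_gt0 _ _ (p j - p i)); rewrite polar_edge eqxx (negPf ij) mul0r subr0.
by case: wp => /(_ i) /lt0r_neq0 H _ _ _; rewrite mul1r invr_eq0.
Qed.

(** The edge from [p i] to [p k] is orthogonal to [w j] but not to [w i]. Hence [u], which is
    [G j j] times the component of [w i] orthogonal to [w j], is nonzero. *)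
Lemma gram2_gt0 k i j : i != j -> i != k -> j != k -> 0 < gram2 i j.
Proof.
move=> ij ik jk.
pose u := G j j *: w i - G i j *: w j.
have /dot_gt0 : dot u (p k - p i) != 0.
  rewrite /u dotDl dotNl !dotZl !polar_edge eqxx (negPf ik) (negPf jk) [j == i]eq_sym.
  rewrite (negPf ij) !mul0r subrr mulr0 !subr0 mul1r.
  by rewrite mulf_neq0 ?invr_eq0 ?lt0r_neq0 ?gram1_gt0 //; case: wp.
suff -> : dot u u = G j j * gram2 i j by rewrite pmulr_rgt0 // gram1_gt0.
rewrite /u /gram2 !dotE (dotC (w j) (w i)); ring.
Qed.

(* [p i - p k] is a negative multiple of the component of [w i] orthogonal to [w j] and [w
   m], since both are orthogonal to [w j] and [w m]. *)
Lemma vertex_edge_sign k i j m : uniq [:: k; i; j; m] ->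
  exists2 c, 0 < c & dot (p i - p k) (p k) = - c * foot_coord i j m.
Proof.
move=> U; case: (wp) => lpos w0 wpE wspan.
move: (U); rewrite /= !inE !negb_or => /andP[/and3P[ki kj km] /andP[/andP[ij im] /andP[jm _]]].
pose D := gram2 j m; have D0 : 0 < D.
  by apply: (@gram2_gt0 k); rewrite // eq_sym.
(* By Cramer's rule, [z] is [D] times the component of [w i] orthogonal to [w j] and [w m]. *)
pose z := D *: w i - (G i j * G m m - G i m * G j m) *: w j
  - (G i m * G j j - G i j * G j m) *: w m.
have zj : dot (w j) z = 0.
  rewrite /z /D /gram2 !dotE (dotC (w j) (w i)); ring.
have zm : dot (w m) z = 0.
  rewrite /z /D /gram2 !dotE (dotC (w m) (w i)) (dotC (w m) (w j)); ring.
have zz : dot z z = D * dot (w i) z.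
  by rewrite {1}/z 2!dotDl !dotNl !dotZl zj zm !mulr0 !subr0.
(* [w i], [w j] and [w m] all pair to 1 with [p k], so the left side is the sum of the coefficients
   of [z]. *)
have zp : dot z (p k) = foot_coord i j m.
  rewrite /z /foot_coord !dotE !wpE [i == k]eq_sym [j == k]eq_sym [m == k]eq_sym.
  rewrite (negPf ki) (negPf kj) (negPf km) !mul0r !subr0 /D; ring.
have [ej em ei] : [/\ dot (w j) (p i - p k) = 0, dot (w m) (p i - p k) = 0
    & dot (w i) (p i - p k) = - (l i)^-1].
  rewrite !polar_edge eqxx [i == k]eq_sym [j == k]eq_sym [m == k]eq_sym.
  rewrite [j == i]eq_sym [m == i]eq_sym.
  by rewrite (negPf ki) (negPf kj) (negPf km) (negPf ij) (negPf im) !mul0r subrr mul1r sub0r.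
have z0 : 0 < dot (w i) z.
  rewrite -(pmulr_rgt0 _ D0) -zz; apply: (@dot_gt0 _ _ (p i - p k)).
  rewrite dotDl dotDl !dotNl !dotZl ej em ei !mulr0 !subr0 mulrN oppr_eq0.
  by rewrite mulf_neq0 ?invr_eq0 ?lt0r_neq0.
pose c := (l i)^-1 / dot (w i) z.
exists c; first by rewrite divr_gt0 ?invr_gt0.
suff -> : p i - p k = - c *: z by rewrite dotZl zp.
apply/eqP; rewrite -subr_eq0; apply/eqP/wspan => n.
have Hi : dot (w i) (p i - p k - - c *: z) = 0.
  rewrite dotDr ei dotNr dotZr /c; field.
  by rewrite !lt0r_neq0.
have Hj : dot (w j) (p i - p k - - c *: z) = 0.
  by rewrite dotDr ej dotNr dotZr zj mulr0 subr0.
have Hm : dot (w m) (p i - p k - - c *: z) = 0.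
  by rewrite dotDr em dotNr dotZr zm mulr0 subr0.
have := mem_ord4 n U; rewrite !inE => /or4P[]/eqP-> //.
(* Only index [k] is left; the relation among the four [w n] reduces it to the other three. *)
have := congr1 (fun x => dot x (p i - p k - - c *: z)) w0.
rewrite (sum_ord4 _ U) dot0l 3!dotDl !dotZl Hi Hj Hm !mulr0 !addr0 => /eqP.
by rewrite mulf_eq0 gt_eqF //= => /eqP.
Qed.


Lemma gram_row i a b c d : uniq [:: a; b; c; d] ->
  l a * G i a + l b * G i b + l c * G i c + l d * G i d = 0.
Proof.
move=> U; have [_ w0 _ _] := wp; have := congr1 (dot (w i)) w0.
by rewrite (sum_ord4 _ U) !dotDr !dotZr [RHS]dotC dot0l.
Qed.

(** Strict Cauchy-Schwarz. It makes each roll from [j] onto [i] strictly lengthen the polar vector,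
    which rules out cycles. *)
Lemma gram_lt k i j : uniq [:: k; i; j] -> G j j <= G i j -> G i j < G i i.
Proof.
rewrite /= !inE !negb_or andbT => /andP[/andP[ki kj] ij].
have D0 : 0 < gram2 i j by apply: (@gram2_gt0 k); rewrite // eq_sym.
have j0 := gram1_gt0 j; move: D0; rewrite /gram2 expr2 => D0 h.
rewrite -(ltr_pM2r j0); have : 0 <= G i j * (G i j - G j j) by rewrite mulr_ge0 //; lra.
lra.
Qed.

Lemma gram_dist_gt0 i j : 0 < gram2 i j -> 0 < G i i + G j j - 2 * G i j.
Proof.
move=> D0; rewrite -(pmulr_rgt0 _ (gram1_gt0 i)).
have -> : G i i * (G i i + G j j - 2 * G i j) = (G i i - G i j) ^+ 2 + gram2 i j.
  rewrite /gram2; ring.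
by rewrite ltr_wpDl ?sqr_ge0.
Qed.

(** Let [q] be the foot of the origin on the line through [w y] and [w z]. Up to the factor
    [|w y - w z|^2], the hypothesis says that [w t] has product at least 0 with [q], and a negative
    coordinate says that [w s] has product above [|q|^2]. As [w y] and [w z] have product exactly
    [|q|^2], the weighted sum could not vanish. *)
Lemma foot_coord_ge0 s t y z : uniq [:: s; t; y; z] ->
  0 <= G t y * (G z z - G y z) + G t z * (G y y - G y z) -> 0 <= foot_coord s y z.
Proof.
move=> U tq; have := U; rewrite /= !inE !negb_or => /andP[/and3P[st sy sz] /andP[_ /andP[yz _]]].
have D0 : 0 < gram2 y z by apply: (@gram2_gt0 s); rewrite // eq_sym.
rewrite leNgt; apply/negP; rewrite /foot_coord subr_lt0 => sq.
have [lpos _ _ _] := wp.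
have : l s * (G s y * (G z z - G y z) + G s z * (G y y - G y z))
     + l t * (G t y * (G z z - G y z) + G t z * (G y y - G y z))
     + (l y + l z) * gram2 y z = 0.
  have Ey := gram_row y U; have Ez := gram_row z U.
  rewrite (dotC (w y) (w s)) (dotC (w y) (w t)) in Ey.
  rewrite (dotC (w z) (w s)) (dotC (w z) (w t)) (dotC (w z) (w y)) in Ez.
  transitivity ((G z z - G y z) * 0 + (G y y - G y z) * 0 : R); last by ring.
  rewrite -{1}Ey -Ez /gram2; ring.
have := mulr_gt0 (lpos s) (lt_trans D0 sq).
have := mulr_ge0 (ltW (lpos t)) tq.
have := mulr_gt0 (addr_gt0 (lpos y) (lpos z)) D0.
lra.
Qed.

(* Split [G s t] along the foot [q] of the origin on the line [w y, w z], along [w y - w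
   z], and orthogonally to both. If the coordinate were negative, every part would be
   nonpositive: [q] separates [w s] from [w t] because the weighted sum of the [w i]
   vanishes, and for the same reason their orthogonal parts are antiparallel. *)
Lemma foot_coord_ge0_opp s t y z : uniq [:: s; t; y; z] -> 0 < G s t ->
  (G s y - G s z) * (G t y - G t z) <= 0 -> 0 <= foot_coord s y z.
Proof.
move=> U st0 m0; have := U; rewrite /= !inE !negb_or => /andP[/and3P[st sy sz] /andP[_ /andP[yz _]]].
have D0 : 0 < gram2 y z by apply: (@gram2_gt0 s); rewrite // eq_sym.
have [tq|tq] := leP 0 (G t y * (G z z - G y z) + G t z * (G y y - G y z)).
  exact: foot_coord_ge0 U tq.
rewrite leNgt; apply/negP; rewrite /foot_coord subr_lt0 => sq.
have [lpos _ _ _] := wp.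
have Ey := gram_row y U; have Ez := gram_row z U; have Es := gram_row s U.
rewrite (dotC (w y) (w s)) (dotC (w y) (w t)) in Ey.
rewrite (dotC (w z) (w s)) (dotC (w z) (w t)) (dotC (w z) (w y)) in Ez.
(* [al] and [be] are the coefficients of the projection of [w s] onto the span of [w y] and [w z],
   scaled by [gram2 y z]. *)
pose al := G s y * G z z - G s z * G y z; pose be := G s z * G y y - G s y * G y z.
have det0 : 0 <= gram2 y z * G s s - al * G s y - be * G s z.
  pose x := gram2 y z *: w s - al *: w y - be *: w z.
  rewrite -(pmulr_rge0 _ D0); have -> : gram2 y z *
    (gram2 y z * G s s - al * G s y - be * G s z) = dot x x; last exact: dot_ge0.
  rewrite /x !(dotDl, dotNl, dotZl) !(dotDr, dotNr, dotZr).
  rewrite (dotC (w y) (w s)) (dotC (w z) (w s)) (dotC (w z) (w y)) /al /be /gram2; ring.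
(* [P] is [gram2 y z] times the product of the projections of [w s] and [w t]. [EP] expresses that
   their orthogonal parts, weighted by [l s] and [l t], cancel. *)
pose P := al * G t y + be * G t z.
have EP : l t * (P - gram2 y z * G s t)
    = l s * (gram2 y z * G s s - al * G s y - be * G s z).
  apply/eqP; rewrite -subr_eq0; apply/eqP.
  transitivity (al * 0 + be * 0 - gram2 y z * 0 : R); last by ring.
  rewrite -{1}Ey -{1}Ez -Es /P /al /be /gram2; ring.
have leP : gram2 y z * G s t <= P.
  by rewrite -subr_ge0 -(pmulr_rge0 _ (lpos t)) EP mulr_ge0 // ltW.
have mm := gram_dist_gt0 D0.
have : (G y y + G z z - 2 * G y z) * P
    = (G s y * (G z z - G y z) + G s z * (G y y - G y z))
    * (G t y * (G z z - G y z) + G t z * (G y y - G y z))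
    + gram2 y z * ((G s y - G s z) * (G t y - G t z)).
  rewrite /P /al /be /gram2; ring.
have := mulr_gt0 mm (lt_le_trans (mulr_gt0 D0 st0) leP).
have : (G s y * (G z z - G y z) + G s z * (G y y - G y z))
    * (G t y * (G z z - G y z) + G t z * (G y y - G y z)) < 0.
  by rewrite nmulr_llt0 // (lt_trans D0 sq).
have : gram2 y z * ((G s y - G s z) * (G t y - G t z)) <= 0 by rewrite pmulr_rle0.
lra.
Qed.

(** * Sign pattern along a path and the resulting vertex equilibria *)

Lemma path_signs a b c d : uniq [:: a; b; c; d] ->
  0 < G a b -> 0 < G b c -> 0 < G c d -> [/\ G a c < 0, G a d < 0 & G b d < 0].
Proof.
move=> U ab bc cd; have [lpos _ _ _] := wp.
have Ea := gram_row a U; have Eb := gram_row b U; have Ec := gram_row c U.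
rewrite (dotC (w b) (w a)) in Eb; rewrite (dotC (w c) (w a)) (dotC (w c) (w b)) in Ec.
have ac : G a c < 0.
  rewrite -(pmulr_rlt0 _ (lpos a)).
  have := mulr_gt0 (lpos b) bc; have := mulr_gt0 (lpos c) (gram1_gt0 c).
  have := mulr_gt0 (lpos d) cd; lra.
have bd : G b d < 0.
  rewrite -(pmulr_rlt0 _ (lpos d)).
  have := mulr_gt0 (lpos a) ab; have := mulr_gt0 (lpos b) (gram1_gt0 b).
  have := mulr_gt0 (lpos c) bc; lra.
(* Pair [l a *: w a + l c *: w c] with the vanishing sum: its squared norm plus the four cross terms
   to [b] and [d] is 0, and three of these are positive. *)
split=> //; rewrite -(pmulr_rlt0 _ (lpos d)) -(pmulr_rlt0 _ (lpos a)).
have := dot_ge0 (l a *: w a + l c *: w c).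
have : 0 < l a * (l b * G a b) + l c * (l b * G b c) + l c * (l d * G c d).
  by rewrite !addr_gt0 ?mulr_gt0.
have : l a * (l a * G a a + l b * G a b + l c * G a c + l d * G a d)
  + l c * (l a * G a c + l b * G b c + l c * G c c + l d * G c d) = 0.
  by rewrite Ea Ec !mulr0 addr0.
rewrite !(dotDl, dotZl) !(dotDr, dotZr) (dotC (w c) (w a)); lra.
Qed.

(** If [G s y <= G s z], the line [w y], [w z] separates as in [foot_coord_ge0_opp]. Otherwise the
    subtracted bracket is [(G s y - G s z) * (G z z - G y z)] plus [G s z] times [|w y - w z|^2],
    both at most 0. *)
Lemma foot_coord_ge0_obtuse s t y z : uniq [:: s; t; y; z] ->
  0 < G s t -> G s z < 0 -> G t z < 0 -> 0 < G t y -> G z z <= G y z ->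
  0 <= foot_coord s y z.
Proof.
move=> U st sz tz ty hz; have := U; rewrite /= !inE !negb_or => /andP[/and3P[_ nsy nsz] /andP[_ /andP[nyz _]]].
have D0 : 0 < gram2 y z by apply: (@gram2_gt0 s); rewrite // eq_sym.
have mm := gram_dist_gt0 D0.
have [h|h] := leP (G s y) (G s z).
  by apply: (foot_coord_ge0_opp U st); rewrite mulr_le0_ge0 //; lra.
rewrite /foot_coord subr_ge0 (le_trans _ (ltW D0)) //.
have : 0 <= (G s y - G s z) * (G y z - G z z) by rewrite mulr_ge0; lra.
have : 0 <= - G s z * (G y y + G z z - 2 * G y z) by rewrite mulr_ge0; lra.
lra.
Qed.

Lemma path_vertices a b c d : uniq [:: a; b; c; d] ->
  G b b <= G a b \/ G a a <= G a b -> G c c <= G b c -> G d d <= G c d ->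
  [/\ 0 < dot (p c - p a) (p a), 0 < dot (p b - p d) (p d),
      forall i, dot (p i - p b) (p b) <= 0 & forall i, dot (p i - p c) (p c) <= 0].
Proof.
move=> U hab hbc hcd.
have ab : 0 < G a b by case: hab => /(lt_le_trans (gram1_gt0 _)).
have bc := lt_le_trans (gram1_gt0 _) hbc; have cd := lt_le_trans (gram1_gt0 _) hcd.
have [ac ad bd] := path_signs U ab bc cd.
have aa := gram1_gt0 a; have bb := gram1_gt0 b.
have cc := gram1_gt0 c; have dd := gram1_gt0 d.
have := U; rewrite /= !inE !negb_or => /andP[/and3P[nab nac nad] /andP[/andP[nbc nbd] /andP[ncd _]]].
have [nba nca nda ncb] : [/\ b != a, c != a, d != a & c != b] by split; rewrite eq_sym.
have [ndb ndc] : d != b /\ d != c by split; rewrite eq_sym.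
have nE := (nab, nac, nad, nbc, nbd, ncd, nba, nca, nda, ncb, ndb, ndc).
have eq0 i : dot (p i - p i) (p i) = 0 by rewrite subrr dot0l.
have edge x y z t : uniq [:: x; y; z; t] ->
    (dot (p y - p x) (p x) <= 0) = (0 <= foot_coord y z t).
  move=> V; have [k k0 ->] := vertex_edge_sign V.
  by rewrite mulNr oppr_le0 pmulr_rge0.
have gt_edge x y z t : uniq [:: x; y; z; t] ->
    foot_coord y z t < 0 -> 0 < dot (p y - p x) (p x).
  by move=> V; rewrite !ltNge (edge _ _ _ _ V).
have [ba cb dc] : [/\ 0 < G b a, 0 < G c b & 0 < G d c] by split; rewrite dotC.
split.
- apply: (gt_edge _ _ b d); first by rewrite /= !inE !negb_or !nE.
  rewrite /foot_coord /gram2 (dotC (w c) (w b)).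
  have : 0 <= G b b * (G c d - G d d) by rewrite mulr_ge0; lra.
  have : 0 < G b c * (G d d - G b d) by rewrite mulr_gt0; lra.
  have : 0 < - G b d * G c d by rewrite mulr_gt0; lra.
  have := sqr_ge0 (G b d); lra.
- apply: (gt_edge _ _ a c); first by rewrite /= !inE !negb_or !nE.
  rewrite /foot_coord /gram2 (dotC (w b) (w a)).
  have : 0 <= G a a * (G b c - G c c) by rewrite mulr_ge0; lra.
  have : 0 < G a b * (G c c - G a c) by rewrite mulr_gt0; lra.
  have : 0 < - G a c * G b c by rewrite mulr_gt0; lra.
  have := sqr_ge0 (G a c); lra.
- move=> i; have := mem_ord4 i U; rewrite !inE => /or4P[]/eqP->; rewrite ?eq0 //.
  + rewrite (edge _ _ c d); last by rewrite /= !inE !negb_or !nE.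
    by apply: (@foot_coord_ge0_obtuse a b); rewrite //= !inE !negb_or !nE.
  + rewrite (edge _ _ a d); last by rewrite /= !inE !negb_or !nE.
    apply: (@foot_coord_ge0_opp c b); rewrite //= ?inE ?negb_or ?nE //.
    by rewrite (dotC (w c)) (dotC (w b) (w a)) mulr_le0_ge0; lra.
  + rewrite (edge _ _ a c); last by rewrite /= !inE !negb_or !nE.
    apply: (@foot_coord_ge0 d b); rewrite //= ?inE ?negb_or ?nE //.
    by rewrite addr_ge0 // mulr_ge0; lra.
- move=> i; have := mem_ord4 i U; rewrite !inE => /or4P[]/eqP->; rewrite ?eq0 //.
  + rewrite (edge _ _ b d); last by rewrite /= !inE !negb_or !nE.
    apply: (@foot_coord_ge0 a c); rewrite //= ?inE ?negb_or ?nE //.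
    by rewrite addr_ge0 // mulr_ge0; lra.
  + rewrite (edge _ _ a d); last by rewrite /= !inE !negb_or !nE.
    apply: (@foot_coord_ge0_opp b c); rewrite //= ?inE ?negb_or ?nE //.
    by rewrite (dotC (w c)) (dotC (w b) (w a)) mulr_ge0_le0; lra.
  (* Only this coordinate, at [d], depends on whether [b] rolls onto [a] or [a] onto [b]. *)
  case: hab => hab.
  + rewrite (edge _ _ a b); last by rewrite /= !inE !negb_or !nE.
    have aab : G a b < G a a by apply: (@gram_lt c) => //=; rewrite !inE !negb_or !nE.
    apply: (@foot_coord_ge0 d c); rewrite //= ?inE ?negb_or ?nE //.
    rewrite (dotC (w c)) addr_ge0 //; first by rewrite mulr_le0; lra.
    by rewrite mulr_ge0; lra.
  + rewrite (edge _ _ b a); last by rewrite /= !inE !negb_or !nE.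
    by apply: (@foot_coord_ge0_obtuse d c); rewrite //= ?inE ?negb_or ?nE // dotC.
Qed.

(** Rolls go to strictly longer vectors, so they form a tree rooted at [f]. A star is excluded,
    since a row of positive Gram entries cannot have weighted sum 0. In the remaining paths [f] is
    an end or next to one, whence the alternative on [a] and [b]. *)
Lemma roll_path f :
  (forall k, k != f -> exists2 i, i != k & G k k <= G i k) ->
  exists a b c d, [/\ uniq [:: a; b; c; d], G b b <= G a b \/ G a a <= G a b,
    G c c <= G b c & G d d <= G c d].
Proof.
move=> roll.
have [x [y [z [U xy yz]]]] : exists x y z,
    [/\ uniq [:: f; x; y; z], G y y <= G x x & G z z <= G y y].
  (* Sort the indices other than [f] by decreasing length: [x] can then roll only onto [f], [y] onto
     [f] or [x], and [z] onto any of the others. *)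
  pose leG i j := G j j <= G i i.
  pose s := sort leG [seq i <- enum 'I_4 | i != f].
  have Ss : size s = 3%N.
    rewrite size_sort size_filter; have := count_predC (pred1 f) (enum 'I_4).
    rewrite (count_uniq_mem _ (enum_uniq _)) mem_enum size_enum_ord => H.
    by apply/eqP; rewrite -(eqn_add2l 1) H.
  have Us : uniq (f :: s).
    by rewrite /= sort_uniq filter_uniq ?enum_uniq // mem_sort mem_filter eqxx.
  have So : sorted leG s by apply: sort_sorted => i j; exact: le_total.
  case: s Ss Us So => [|x [|y [|z []]]] //= _ Us /and3P[h1 h2 _].
  by exists x, y, z.
have := U; rewrite /= !inE !negb_or => /andP[/and3P[nfx nfy nfz] /andP[/andP[nxy nxz] /andP[nyz _]]].
have [nxf nyf nzf nyx] : [/\ x != f, y != f, z != f & y != x] by split; rewrite eq_sym.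
have [nzx nzy] : z != x /\ z != y by split; rewrite eq_sym.
have nE := (nfx, nfy, nfz, nxy, nxz, nyz, nxf, nyf, nzf, nyx, nzx, nzy).
have up k i j : uniq [:: k; i; j] -> G j j <= G i j -> G i i <= G j j -> False.
  by move=> V h1 h2; have := lt_le_trans (le_lt_trans h1 (gram_lt V h1)) h2; rewrite ltxx.
have [lpos _ _ _] := wp.
have star k i j m : uniq [:: k; i; j; m] -> 0 < G k i -> 0 < G k j -> 0 < G k m -> False.
  move=> V ki kj km; have := gram_row k V.
  have := mulr_gt0 (lpos k) (gram1_gt0 k); have := mulr_gt0 (lpos i) ki.
  have := mulr_gt0 (lpos j) kj; have := mulr_gt0 (lpos m) km; lra.
have pos i j : G j j <= G i j -> 0 < G i j := lt_le_trans (gram1_gt0 j).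
have fx : G x x <= G f x.
  have [i ix h] := roll x nxf; have := mem_ord4 i U; rewrite !inE => /or4P[]/eqP E; subst i => //.
  - by rewrite eqxx in ix.
  - by case: (up f y x); rewrite //= !inE !negb_or !nE.
  - by case: (up f z x); rewrite //= ?inE ?negb_or ?nE // (le_trans yz).
have [i iy hy] := roll y nyf; have := mem_ord4 i U; rewrite !inE => /or4P[]/eqP E; subst i.
- have [j jz hz] := roll z nzf; have := mem_ord4 j U; rewrite !inE => /or4P[]/eqP E; subst j.
  + by case: (star f x y z); [exact: U|exact: pos..].
  + exists y, f, x, z; split=> //; first by rewrite /= !inE !negb_or !nE.
    by right; rewrite dotC.
  + exists x, f, y, z; split=> //; first by rewrite /= !inE !negb_or !nE.
    by right; rewrite dotC.
  + by rewrite eqxx in jz.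
- have [j jz hz] := roll z nzf; have := mem_ord4 j U; rewrite !inE => /or4P[]/eqP E; subst j.
  + exists z, f, x, y; split=> //; first by rewrite /= !inE !negb_or !nE.
    by right; rewrite dotC.
  + case: (star x f y z); [|by rewrite dotC pos|exact: pos..].
    by rewrite /= !inE !negb_or !nE.
  + by exists f, x, y, z; split=> //; left.
  + by rewrite eqxx in jz.
- by rewrite eqxx in iy.
- by case: (up f z y); rewrite //= !inE !negb_or !nE.
Qed.

End Polar.

(** * Construction of the polar tetrahedron *)

Lemma bary_gradients (R : realType) (v : 'I_4 -> 'rV[R]_3) : aff_indep v ->
  exists g : 'I_4 -> 'rV[R]_3,
  [/\ forall k i j, dot (g k) (v i - v j) = (k == i)%:R - (k == j)%:R,
      \sum_i g i = 0 & forall x, (forall k, dot (g k) x = 0) -> x = 0].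
Proof.
rewrite /aff_indep; set M := \matrix_(i, j) _ => detM.
have uM : M \in unitmx by rewrite unitmxE unitfE.
pose h i : 'rV_3 := (col i (invmx M))^T.
have hM k i : dot (h k) (v (lift ord0 i) - v ord0) = (k == i)%:R.
  have := congr1 (fun A : 'M_3 => A i k) (mulmxV uM); rewrite !mxE eq_sym => <-.
  by apply: eq_bigr => j _; rewrite !mxE mulrC.
(* These are the gradients of the barycentric coordinates; the one at [ord0] is forced because the
   coordinates have constant sum. *)
pose g i := if unlift ord0 i is Some j then h j else - \sum_j h j.
have gM k i : dot (g k) (v i - v ord0) = (k == i)%:R - (k == ord0)%:R.
  rewrite /g; case: (unliftP ord0 i) => [i'|] ->; last first.
    by rewrite !subrr dotC dot0l.
  case: (unliftP ord0 k) => [k'|] -> /=.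
    by rewrite hM (inj_eq lift_inj) subr0.
  rewrite dotNl dot_suml (bigD1 i') //= hM eqxx big1 ?addr0 ?sub0r // => j ji.
  by rewrite hM (negPf ji).
exists g; split=> [k i j||x x0].
- have -> : v i - v j = (v i - v ord0) - (v j - v ord0) by rewrite opprB addrA subrK.
  by rewrite dotDr dotNr !gM; ring.
- rewrite big_ord_recl {1}/g unlift_none; apply/eqP; rewrite addrC subr_eq0; apply/eqP.
  by apply: eq_bigr => i _; rewrite /g liftK.
- have x0' : x *m invmx M = 0.
    apply/rowP => k; rewrite !mxE -[RHS](x0 (lift ord0 k)) dotC /g liftK.
    by apply: eq_bigr => j _; rewrite !mxE.
  by rewrite -[x](mulmxKV uM) x0' mul0mx.
Qed.

Lemma interior_polar_pair (R : realType) (v : 'I_4 -> 'rV[R]_3) (O : 'rV[R]_3) :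
  aff_indep v -> interior v O ->
  exists w l, \sum_i l i = 1 /\ polar_pair w (fun i => v i - O) l.
Proof.
move=> /bary_gradients[g [gv g0 gspan]] [eps [eps0 inO]].
have gcomb k (c : 'I_4 -> R) : \sum_i c i = 1 ->
    dot (g k) (\sum_i c i *: v i - v k) = c k - 1.
  move=> c1; have -> : \sum_i c i *: v i - v k = \sum_i c i *: (v i - v k).
    rewrite (eq_bigr _ (fun i _ => scalerBr _ _ _)) sumrB -scaler_suml c1.
    by rewrite scale1r.
  rewrite dotC dot_suml (bigD1 k) //= subrr scaler0 dot0l add0r.
  rewrite -c1 [in RHS](bigD1 k) //= opprD addrA subrr sub0r -sumrN.
  apply: eq_bigr => i ik; rewrite dotZl dotC gv eqxx [k == i]eq_sym (negPf ik).
  by rewrite sub0r mulrN1.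
have [|l [l0 [_ [l1 Ol]]]] := inO O; first by rewrite subrr dot0l.
have lpos k : 0 < l k.
  have [j jk] : exists j, k != j.
    by case: (eqVneq k ord0) => [->|]; [exists ord_max | exists ord0].
  have N0 : 0 < dot (g k) (g k).
    by apply: (@dot_gt0 _ _ (v k - v j)); rewrite gv eqxx (negPf jk) subr0 oner_neq0.
  set N := dot _ _ in N0.
  (* Moving from [O] by [- s *: g k] costs squared distance [eps * N / (N + 1) < eps], so the point
     stays in the hull; its coordinate [l k - s * N] being nonnegative gives [0 < l k]. *)
  pose s := Num.sqrt (eps / (N + 1)).
  have N1 : 0 < N + 1 by rewrite addr_gt0.
  have s0 : 0 < s by rewrite sqrtr_gt0 divr_gt0.
  have [|c [c0 [_ [c1 yc]]]] := inO (O - s *: g k).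
    rewrite addrAC subrr sub0r dotNl dotNr opprK dotZl dotZr mulrA -expr2.
    rewrite sqr_sqrtr ?divr_ge0 ?ltW // -/N mulrAC ltr_pdivrMr // ltr_pM2l //.
    by rewrite ltrDl.
  have := gcomb k c c1; rewrite -yc addrAC dotDr [in X in dot _ (X - v k)]Ol gcomb //.
  rewrite dotNr dotZr -/N; have := c0 k; have := mulr_gt0 s0 N0; lra.
exists (fun k => - (l k)^-1 *: g k), l; split=> //; split=> //.
- rewrite (eq_bigr (fun i => - g i)) ?sumrN ?g0 ?oppr0 // => i _.
  by rewrite scalerA mulrN divff ?scaleN1r // lt0r_neq0.
- move=> k i; have -> : v i - O = (v i - v k) - (O - v k) by rewrite opprB addrA subrK.
  rewrite dotZl dotDr dotNr Ol gcomb // gv eqxx /=; move: (_%:R) => e; field.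
  by rewrite lt0r_neq0.
- move=> x x0; apply: gspan => k; have /eqP := x0 k.
  by rewrite dotZl mulf_eq0 oppr_eq0 invr_eq0 gt_eqF //= => /eqP.
Qed.

(** * Hulls and equilibria in terms of polar vectors *)

Section Equilibria.
Context (R : realType) (v w : 'I_4 -> 'rV[R]_3) (O : 'rV[R]_3) (l : 'I_4 -> R).
Hypothesis l1 : \sum_i l i = 1.
Hypothesis wp : polar_pair w (fun i => v i - O) l.

(** The barycentric coordinate of [y] at [v k]: it vanishes on the plane of the opposite face and
    equals [l k] at [O]. *)
Definition bary y k := l k * (1 - dot (w k) (y - O)).

Lemma bary_comb c k : \sum_i c i = 1 -> bary (\sum_i c i *: v i) k = c k.
Proof.
have [lpos _ wv _] := wp => c1.
have -> : \sum_i c i *: v i = O + \sum_i c i *: (v i - O).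
  rewrite (eq_bigr _ (fun i _ => scalerBr _ _ _)) sumrB -scaler_suml c1 scale1r.
  by rewrite addrC subrK.
rewrite /bary addrAC subrr add0r dotC dot_suml.
have -> : \sum_i dot (c i *: (v i - O)) (w k) = 1 - c k / l k.
  rewrite -c1 [in RHS](bigD1 k) // [in LHS](bigD1 k) //= dotZl dotC wv eqxx.
  rewrite (eq_bigr c) => [|i ik]; first by rewrite /=; ring.
  by rewrite dotZl dotC wv eq_sym (negPf ik) mul0r subr0 mulr1.
by field; rewrite lt0r_neq0.
Qed.

Lemma sum_bary y : \sum_k bary y k = 1.
Proof.
have [_ w0 _ _] := wp; rewrite /bary.
rewrite (eq_bigr (fun k => l k - dot (l k *: w k) (y - O))) => [|k _]; last first.
  by rewrite dotZl; ring.
by rewrite sumrB -dot_suml w0 dot0l subr0.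
Qed.

Lemma baryK y : \sum_k bary y k *: v k = y.
Proof.
have [lpos w0 wv wspan] := wp.
apply/eqP; rewrite -subr_eq0; apply/eqP; apply: wspan => j.
have := bary_comb j (sum_bary y); rewrite {1 3}/bary => /(mulfI (lt0r_neq0 (lpos j))) H.
have -> : \sum_k bary y k *: v k - y = (\sum_k bary y k *: v k - O) - (y - O).
  by rewrite opprB addrA subrK.
by rewrite dotDr dotNr; lra.
Qed.

Lemma affP S y : aff v S y <-> forall k, k \notin S -> bary y k = 0.
Proof.
split=> [[c [c0 [c1 ->]]] k kS|H]; first by rewrite bary_comb ?c0.
by exists (bary y); rewrite sum_bary baryK.
Qed.

Lemma hullP S y :
  hull v S y <-> (forall k, 0 <= bary y k) /\ (forall k, k \notin S -> bary y k = 0).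
Proof.
split=> [[c [c0 [cS [c1 ->]]]]|[H HS]]; last by exists (bary y); rewrite sum_bary baryK.
by split=> [k|k kS]; rewrite bary_comb // cS.
Qed.

Lemma bary_vertex i k : bary (v i) k = (i == k)%:R.
Proof.
have [lpos _ wv _] := wp; rewrite /bary wv eq_sym; field.
by rewrite lt0r_neq0.
Qed.

Lemma hull_vertex i : hull v setT (v i).
Proof.
by apply/hullP; split=> k; rewrite ?bary_vertex ?ler0n // inE.
Qed.

Lemma aff_set1 k y : aff v [set k] y -> y = v k.
Proof.
move=> /affP H; rewrite -(baryK y) (bigD1 k) //= big1 => [|i ik]; last first.
  by rewrite H ?scale0r // inE.
have := sum_bary y; rewrite (bigD1 k) //= big1 => [|i ik]; last by rewrite H // inE.
by rewrite !addr0 => ->; rewrite scale1r.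
Qed.

Lemma hull_dot_le x y c : hull v setT x -> (forall i, dot (v i - O) y <= c) ->
  dot (x - O) y <= c.
Proof.
move=> /hullP[x0 _] H; have -> : x - O = \sum_i bary x i *: (v i - O).
  rewrite (eq_bigr _ (fun i _ => scalerBr _ _ _)) sumrB -scaler_suml sum_bary.
  by rewrite baryK scale1r.
rewrite dot_suml -[c]mul1r -(sum_bary x) mulr_suml; apply: ler_sum => i _.
by rewrite dotZl ler_wpM2l.
Qed.

Lemma vertex_equilibriumP k : equilibrium_on v O [set k] <->
  forall i, dot ((v i - O) - (v k - O)) (v k - O) <= 0.
Proof.
have [lpos w0 wv wspan] := wp.
have [j jk] : exists j, j != k.
  by case: (eqVneq ord0 k) => [<-|]; [exists ord_max | exists ord0].
have pk : 0 < dot (v k - O) (v k - O).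
  by apply: (@dot_gt0 _ _ (w j)); rewrite dotC wv (negPf jk) mul0r subr0 oner_neq0.
have hk : hull v [set k] (v k).
  apply/hullP; split=> i; rewrite bary_vertex ?ler0n //.
  by rewrite inE eq_sym => /negPf->.
split=> [[Q [[/hullP[_ HQ] _] [QO [_ Qs]]]] i|H].
  have QE : Q = v k by apply/aff_set1/affP.
  have E : v i - O - (v k - O) = v i - v k by rewrite opprB addrA subrK.
  rewrite E -QE; case: Qs => [|/(_ O)]; first by apply; exact: hull_vertex.
  (* The reverse inequality fails at [O] itself, which lies in the hull. *)
  have hO : hull v setT O.
    apply/hullP; split=> m; last by rewrite inE.
    by rewrite /bary subrr dotC dot0l subr0 mulr1 ltW.
  by move=> /(_ hO); rewrite QE -opprB dotNl oppr_ge0 leNgt pk.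
exists (v k); split.
  split=> //; exists 1; split=> // y /aff_set1 -> _; exact: hk.
split; first by apply/eqP => E; move: pk; rewrite E subrr dot0l ltxx.
split; first exact: hull_vertex.
left=> x hx; have -> : x - v k = (x - O) - (v k - O) by rewrite opprB addrA subrK.
rewrite dotDl dotNl subr_le0; apply: hull_dot_le => // i.
by rewrite -subr_le0 -dotNl -dotDl.
Qed.

(** The witness is the foot of [O] on the plane of the face. Its barycentric coordinate at [v i] is
    positive exactly when [dot (w i) (w k) < dot (w k) (w k)]. *)
Lemma face_equilibrium k :
  (forall i, i != k -> dot (w i) (w k) < dot (w k) (w k)) ->
  equilibrium_on v O (~: [set k]).
Proof.
move=> H; have [lpos w0 wv wspan] := wp.
have n0 : 0 < dot (w k) (w k) := gram1_gt0 wp k.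
pose Q := O + (dot (w k) (w k))^-1 *: w k.
have QO : Q - O = (dot (w k) (w k))^-1 *: w k by rewrite addrAC subrr add0r.
have bQk : bary Q k = 0.
  by rewrite /bary QO dotZr mulVf ?subrr ?mulr0 // lt0r_neq0.
have bQ i : i != k -> 0 < bary Q i.
  move=> ik; rewrite /bary QO dotZr mulr_gt0 // subr_gt0 mulrC ltr_pdivrMr // mul1r.
  exact: H.
have bQ0 i : 0 <= bary Q i by have [->|/bQ/ltW//] := eqVneq i k; rewrite bQk.
exists Q; split; [split|split].
- apply/hullP; split=> // i; rewrite !inE negbK => /eqP->; exact: bQk.
(* By Cauchy-Schwarz, coordinate [i] stays nonnegative within squared distance [e i] of [Q]. *)
- pose e i := (bary Q i / l i) ^+ 2 / dot (w i) (w i).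
  have e0 i : i != k -> 0 < e i.
    by move=> ik; rewrite divr_gt0 ?exprn_gt0 ?divr_gt0 ?bQ ?(gram1_gt0 wp).
  exists (\big[Num.min/1]_(i | i != k) e i); split.
    by apply: lt_bigmin.
  move=> y /affP yk yQ; apply/hullP; split=> // i.
  have [->|ik] := eqVneq i k; first by rewrite yk // !inE eqxx.
  have Ey : bary y i = l i * (bary Q i / l i - dot (w i) (y - Q)).
    have -> : y - Q = (y - O) - (Q - O) by rewrite opprB addrA subrK.
    rewrite /bary dotDr dotNr; field; by rewrite lt0r_neq0.
  rewrite Ey pmulr_rge0 // subr_ge0 leNgt; apply/negP => lt.
  have : dot (w i) (y - Q) ^+ 2 < (bary Q i / l i) ^+ 2.
    apply: le_lt_trans (dot_CS _ _) _.
    rewrite -ltr_pdivlMl ?(gram1_gt0 wp) // mulrC (lt_le_trans yQ) //.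
    exact: bigmin_le_cond.
  rewrite ltNge lerXn2r ?nnegrE ?ltW //.
  - by rewrite divr_gt0 ?bQ.
  - by apply: lt_trans lt; rewrite divr_gt0 ?bQ.
- apply/eqP => E; move/eqP: QO; rewrite E subrr eq_sym scaler_eq0 invr_eq0 gt_eqF //=.
  by move/eqP=> wk; move: n0; rewrite wk dot0l ltxx.
split; first by apply/hullP; split=> // i; rewrite inE.
left=> x hx; have -> : x - Q = (x - O) - (Q - O) by rewrite opprB addrA subrK.
rewrite {2}QO dotZr pmulr_rle0 ?invr_gt0 // dotDl dotNl QO dotZl mulVf ?lt0r_neq0 //.
rewrite subr_le0; apply: hull_dot_le => // i.
by rewrite dotC wv gerBl divr_ge0 ?ler0n // ltW.
Qed.

End Equilibria.

(** * From monostability to the two unstable vertices *)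

Unset Implicit Arguments.

Theorem theorem1p8 (R : realType) (v : 'I_4 -> 'rV[R]_3) (O : 'rV[R]_3) :
  aff_indep v -> interior v O -> monostable v O ->
  exists i j : 'I_4, [/\ i != j, equilibrium_on v O [set i],
    equilibrium_on v O [set j] &
    forall k : 'I_4, equilibrium_on v O [set k] -> k = i \/ k = j].
Proof.
move=> vI /(interior_polar_pair vI)[w [l [l1 wp]]] [F [F3 _ Funiq]].
have [f FE] : exists f, F = ~: [set f].
  have /cards1P[f fE] : #|~: F| == 1%N.
    by rewrite -(eqn_add2l #|F|) cardsC F3 card_ord.
  by exists f; rewrite -fE setCK.
(* If no such [i] existed, the face opposite [v k] would carry a second stable equilibrium. *)
have roll k : k != f -> exists2 i, i != k & dot (w k) (w k) <= dot (w i) (w k).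
  move=> kf; case: (pickP [pred i | (i != k) && (dot (w k) (w k) <= dot (w i) (w k))]).
    by move=> i /andP[ik h]; exists i.
  move=> no; have eqk : equilibrium_on v O (~: [set k]).
    apply: (face_equilibrium l1 wp) => i ik; have := no i.
    by rewrite /= ik /= ltNge => ->.
  have := Funiq _ _ eqk; rewrite FE cardsC1 card_ord => /(_ erefl)/setC_inj/set1_inj kE.
  by rewrite kE eqxx in kf.
have [a [b [c [d [U hab hbc hcd]]]]] := roll_path wp roll.
have [ha hd hb hc] := path_vertices wp U hab hbc hcd.
exists b, c; split.
- by move: U; rewrite /= !inE !negb_or => /and4P[_ /andP[]].
- exact/(vertex_equilibriumP l1 wp).
- exact/(vertex_equilibriumP l1 wp).
move=> k /(vertex_equilibriumP l1 wp) hk; have := mem_ord4 k U.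
rewrite !inE => /or4P[]/eqP E; subst k; [|by left|by right|].
- by have := hk c; rewrite leNgt ha.
- by have := hk b; rewrite leNgt hd.
Qed.
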